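(* Let $\mathcal B$ be a separable complex Banach space, let $U\subset\mathbb C$ be open and connected, let $z_0\in U$, and let $A:U\to\mathcal L_{\mathcal B}$ be an analytic function such that $A(z)$ is Fredholm for every $z\in U$, invertible for every $z\in U\setminus\{z_0\}$, and not invertible at $z=z_0$. Let $A_{j,z_0}$, $P_k$, $Q_k$, $A^{[k]}$ and $d>0$ be as in the context, with $A^{[d]}(z_0)$ invertible, and suppose that $P_0=0$, $P_d\ne I$, and $P_{d+j}=I$ for $j>0$; thus $A(z)^{-1}$ has a pole of order $d$ at $z_0$. Write, near $z_0$, $$A^{[d]}(z)=\sum_{j=0}^\infty G_{j,z_0}(z-z_0)^j,\qquad (A^{[d]}(z))^{-1}=\sum_{j=0}^\infty H_{j,z_0}(z-z_0)^j.$$ Then for all $k\ge0$ $$G_{k,z_0}=\sum_{j=0}^d(P_{j+1}-P_j)A_{k+j,z_0},$$ and $$H_{j,z_0}=\begin{cases}G_{0,z_0}^{-1}&\text{if }j=0,\\-G_{0,z_0}^{-1}\sum_{k=1}^jG_{k,z_0}H_{j-k,z_0}&\text{if }j\ge1.\end{cases}$$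
   Context: $\mathcal L_{\mathcal B}$ is the space of bounded linear operators on $\mathcal B$ and $I$ is the identity. A projection is a bounded idempotent operator. An operator $T\in\mathcal L_{\mathcal B}$ is Fredholm if $\dim(\ker T)<\infty$ and $\dim(\operatorname{coker}T)<\infty$. The operators $A_{j,z_0}\in\mathcal L_{\mathcal B}$ are the Taylor coefficients of $A$ at $z_0$: $A(z)=\sum_{j=0}^\infty A_{j,z_0}(z-z_0)^j$. Successive factorization: starting from $A^{[0]}=A$, for $k=1,2,\ldots$ let $P_k$ be a projection with $\operatorname{ran}P_k=\operatorname{ran}A^{[k-1]}(z_0)$ (no other requirement is imposed on $P_k$; in particular its kernel may be any convenient choice), let $Q_k=I-P_k$, and let $A^{[k]}$, called the Fredholm quotient of order $k$, be the analytic function on $U$, with values Fredholm operators of index zero, satisfying $A^{[k-1]}(z)=(P_k+(z-z_0)Q_k)A^{[k]}(z)$ for $z\in U$ (so $A^{[k]}(z)=(P_k+(z-z_0)^{-1}Q_k)A^{[k-1]}(z)$ for $z\ne z_0$, extended analytically to $z_0$). The integer $d>0$ is such that $A(z)=(P_1+(z-z_0)Q_1)\cdots(P_d+(z-z_0)Q_d)A^{[d]}(z)$ with $A^{[d]}$ analytic and $A^{[d]}(z_0)$ invertible; then $\operatorname{ran}P_1\subset\cdots\subset\operatorname{ran}P_d$.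
   Formalization: The nesting ran P_1 ⊂ … ⊂ ran P_d, stated as a consequence in the source, is assumed: it can fail, and then so does the G formula, e.g. A(z)=[[1,0],[z,z^2]], z_0=0, P_1=diag(1,0), P_2=[[1,0],[1,0]], d=2. *)

(* Defs.v *)
From HB Require Import structures.
From mathcomp Require Import all_boot all_order all_algebra.
From mathcomp Require Import complex.
From mathcomp Require Import all_classical all_reals all_analysis.
Set Implicit Arguments.
Unset Strict Implicit.
Unset Printing Implicit Defensive.
Import Order.TTheory GRing.Theory Num.Theory.
Import numFieldNormedType.Exports.
Local Open Scope classical_set_scope.
Local Open Scope complex_scope.
Local Open Scope ring_scope.

(* R[i] with the topology of its modulus. *)
HB.instance Definition _ (R : realType) := NormedModule.copy R[i] R[i]^o.

Section BoundedOperators.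
Variables (R : realType) (B : normedModType R[i]).

Definition bounded_linear : {pred B -> B} :=
  [pred f | `[< linear f /\ exists M : R[i], forall x, `|f x| <= M * `|x| >]].

Record boundedop := BoundedOp {
  boundedop_fun :> B -> B;
  boundedopP : boundedop_fun \in bounded_linear }.

HB.instance Definition _ := [isSub for boundedop_fun].
HB.instance Definition _ := gen_eqMixin boundedop.
HB.instance Definition _ := gen_choiceMixin boundedop.

Lemma bounded_linear_submod_closed : submod_closed bounded_linear.
Proof.
split.
  apply/asboolP; split; first by move=> a x y /=; rewrite scaler0 addr0.
  by exists 0 => x; rewrite normr0 mul0r.
move=> a f g /asboolP[fl [M fM]] /asboolP[gl [N gN]].
have E x : (a *: f + g) x = a *: f x + g x by [].
apply/asboolP; split.
  move=> b x y; rewrite !E fl gl !scalerDr !scalerA [a * b]mulrC.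
  by rewrite -!addrA; congr (_ + _); rewrite addrCA.
exists (`|a| * M + N) => x; rewrite E mulrDl (le_trans (ler_normD _ _))//.
by rewrite lerD ?gN// normrZ -mulrA ler_wpM2l.
Qed.

HB.instance Definition _ :=
  GRing.isSubmodClosed.Build _ _ bounded_linear bounded_linear_submod_closed.
HB.instance Definition _ := [SubChoice_isSubLmodule of boundedop by <:].

Lemma boundedop_ext (S T : boundedop) : (forall x, S x = T x) -> S = T.
Proof. by move=> ST; apply/val_inj/funext. Qed.

Lemma boundedop_linear (T : boundedop) : linear T.
Proof. by case: T => f /= /asboolP[]. Qed.

HB.instance Definition _ (T : boundedop) :=
  GRing.isLinear.Build _ _ _ _ (boundedop_fun T) (boundedop_linear T).

Lemma id_bounded_linear : (fun x : B => x) \in bounded_linear.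
Proof. by apply/asboolP; split=> //; exists 1 => x; rewrite mul1r. Qed.

Lemma boundedop_bound (T : boundedop) :
  exists2 M : R, 0 <= M & forall x, `|T x| <= M%:C * `|x|.
Proof.
case: T => f /= /asboolP[fl [M fM]]; exists `|complex.Re M| => // x.
have [->|x0] := eqVneq x 0.
  have := fl (- 1) 0 0; rewrite scaler0 addr0 scaleN1r addNr => ->.
  by rewrite !normr0 mulr0.
have M0 : 0 <= M.
  by rewrite -(@pmulr_lge0 _ `|x|) ?normr_gt0// (le_trans _ (fM x)).
apply: (le_trans (fM x)); rewrite ler_wpM2r//.
move: M0; rewrite !lecE/= => /andP[/eqP -> _]; rewrite eqxx/=.
exact: ler_norm.
Qed.

Lemma comp_bounded_linear (S T : boundedop) : (S \o T) \in bounded_linear.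
Proof.
apply/asboolP; split=> [a x y /=|]; first by rewrite !linearP.
have [M M0 SM] := boundedop_bound S; have [N N0 TN] := boundedop_bound T.
exists (M%:C * N%:C) => x /=; rewrite (le_trans (SM _))// -mulrA ler_wpM2l//.
by rewrite lecR.
Qed.

Definition boundedop_one := BoundedOp id_bounded_linear.
Definition boundedop_mul (S T : boundedop) :=
  BoundedOp (comp_bounded_linear S T).

Fact boundedop_mulA : associative boundedop_mul.
Proof. by move=> S T V; apply/boundedop_ext. Qed.

Fact boundedop_mul1r : left_id boundedop_one boundedop_mul.
Proof. by move=> T; apply/boundedop_ext. Qed.

Fact boundedop_mulr1 : right_id boundedop_one boundedop_mul.
Proof. by move=> T; apply/boundedop_ext. Qed.

Fact boundedop_mulDl : left_distributive boundedop_mul +%R.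
Proof. by move=> S T V; apply/boundedop_ext. Qed.

Fact boundedop_mulDr : right_distributive boundedop_mul +%R.
Proof. by move=> S T V; apply/boundedop_ext => x /=; rewrite linearD. Qed.

HB.instance Definition _ := GRing.Zmodule_isPzRing.Build boundedop
  boundedop_mulA boundedop_mul1r boundedop_mulr1
  boundedop_mulDl boundedop_mulDr.

(* The norm of B takes its values in R[i], hence the real part. *)
Definition opnorm (T : boundedop) : R[i] :=
  (sup [set complex.Re `|T x| | x in [set x | `|x| <= 1]])%:C.


Lemma normB_real (x : B) : `|x| = (complex.Re `|x|)%:C.
Proof. by have /ger0_real/complex_realP[k ->] := normr_ge0 x. Qed.

Let img (T : boundedop) : set R :=
  [set complex.Re `|T x| | x in [set x | `|x| <= 1]].

Lemma opnorm_has_sup T : has_sup (img T).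
Proof.
have [M M0 TM] := boundedop_bound T.
split; first by exists (complex.Re `|T 0|), 0 => //=; rewrite normr0.
exists M => _ [x /= x1 <-]; rewrite -lecR -normB_real (le_trans (TM x))//.
by rewrite ler_piMr// lecR.
Qed.

Lemma opnorm_ge0 T : 0 <= opnorm T.
Proof.
rewrite -[0]/(0%:C) /opnorm lecR.
apply: ub_le_sup; first by case: (opnorm_has_sup T).
by exists 0; rewrite /= ?normr0// linear0 normr0.
Qed.

Lemma opnormP (T : boundedop) x : `|T x| <= opnorm T * `|x|.
Proof.
have [->|x0] := eqVneq x 0; first by rewrite linear0 !normr0 mulr0.
have nx : 0 < `|x| by rewrite normr_gt0.
rewrite -ler_pdivrMr// mulrC -[_^-1]ger0_norm ?invr_ge0// -normrZ -linearZ.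
rewrite [leLHS]normB_real /opnorm lecR.
apply: ub_le_sup; first by case: (opnorm_has_sup T).
exists (`|x|^-1 *: x) => //=.
by rewrite normrZ ger0_norm ?invr_ge0// mulVf ?gt_eqF.
Qed.

Lemma opnorm_le (T : boundedop) (M : R[i]) :
  0 <= M -> (forall x, `|T x| <= M * `|x|) -> opnorm T <= M.
Proof.
move=> M0 TM; have /complex_realP[k Mk] := ger0_real M0.
rewrite Mk /opnorm lecR; apply: ge_sup; first by case: (opnorm_has_sup T).
move=> _ [x /= x1 <-]; rewrite -lecR -normB_real -Mk (le_trans (TM x))//.
by rewrite ler_piMr.
Qed.

Lemma ler_opnormD S T : opnorm (S + T) <= opnorm S + opnorm T.
Proof.
apply: opnorm_le => [|x]; first by rewrite addr_ge0 ?opnorm_ge0.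
by rewrite mulrDl (le_trans (ler_normD _ _))// lerD ?opnormP.
Qed.

Lemma opnorm0_eq0 T : opnorm T = 0 -> T = 0.
Proof.
move=> T0; apply/boundedop_ext => x; apply/eqP.
by rewrite -normr_le0 (le_trans (opnormP T x))// T0 mul0r.
Qed.

Lemma opnormZ a T : opnorm (a *: T) = `|a| * opnorm T.
Proof.
have leZ b V : opnorm (b *: V) <= `|b| * opnorm V.
  apply: opnorm_le => [|x]; first by rewrite mulr_ge0 ?opnorm_ge0.
  by rewrite normrZ -mulrA ler_wpM2l ?opnormP.
apply/eqP; rewrite eq_le leZ/=.
have [->|a0] := eqVneq a 0; first by rewrite normr0 mul0r opnorm_ge0.
rewrite -ler_pdivlMl ?normr_gt0//.
by rewrite -[X in opnorm X <= _](scalerK a0) (le_trans (leZ _ _))// normfV.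
Qed.

HB.instance Definition _ := Lmodule_isNormed.Build R[i] boundedop
  ler_opnormD opnormZ opnorm0_eq0.

End BoundedOperators.

Definition separable (T : topologicalType) : Prop :=
  exists2 D : set T, countable D & dense D.

Section OperatorFunctions.
Variables (R : realType) (B : normedModType R[i]).
Local Notation L := (boundedop B).

Definition op_is_inverse (T S : L) : Prop := S * T = 1 /\ T * S = 1.

Definition op_invertible (T : L) : Prop := exists S, op_is_inverse T S.

(* Equal to 0 when T is not invertible. *)
Definition op_inv (T : L) : L := get (op_is_inverse T).

Definition has_dim (V : set B) (n : nat) : Prop :=
  exists2 e : 'I_n -> B, (forall i, V (e i)) &
    forall x, V x ->
      exists! c : {ffun 'I_n -> R[i]}, x = \sum_(i < n) c i *: e i.

(* n is the dimension of B / V: the classes of the e i form a basis. *)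
Definition has_codim (V : set B) (n : nat) : Prop :=
  exists e : 'I_n -> B, forall x,
    exists! c : {ffun 'I_n -> R[i]}, V (x - \sum_(i < n) c i *: e i).

Definition op_ker (T : L) : set B := [set x | T x = 0].

Definition fredholm (T : L) : Prop :=
  (exists m, has_dim (op_ker T) m) /\ (exists n, has_codim (range T) n).

Definition fredholm_of_index (T : L) (ind : int) : Prop :=
  exists m n, [/\ has_dim (op_ker T) m, has_codim (range T) n &
                  ind = m%:Z - n%:Z].

Definition projection (P : L) : Prop := P * P = P.

Definition taylor (f : R[i] -> L) (w : R[i]) (a : nat -> L) : Prop :=
  \forall z \near w, [series (z - w) ^+ j *: a j]_j @ \oo --> f z.

Definition analytic_on (U : set R[i]) (f : R[i] -> L) : Prop :=
  forall w, U w -> exists a, taylor f w a.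

Definition pole_of_order (f : R[i] -> L) (w : R[i]) (d : nat) : Prop :=
  exists2 a : nat -> L, a 0%N != 0 &
    \forall z \near w^',
      [series (z - w) ^ (j%:Z - d%:Z) *: a j]_j @ \oo --> f z.

(* P 0 is unconstrained, and so are the kernels of the projections P k.+1;
   Aq k.+1 is the Fredholm quotient of order k.+1. *)
Definition fredholm_quotients (U : set R[i]) (z0 : R[i]) (A : R[i] -> L)
    (P : nat -> L) (Aq : nat -> R[i] -> L) : Prop :=
  (forall z, U z -> Aq 0%N z = A z) /\
  forall k,
    [/\ projection (P k.+1),
        range (P k.+1) = range (Aq k z0),
        analytic_on U (Aq k.+1),
        forall z, U z -> fredholm_of_index (Aq k.+1 z) 0
      & forall z, U z ->
          Aq k z = (P k.+1 + (z - z0) *: (1 - P k.+1)) * Aq k.+1 z].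

End OperatorFunctions.

(* Main.v *)
Require Import Defs.
From HB Require Import structures.
From mathcomp Require Import all_boot all_order all_algebra.
From mathcomp Require Import complex.
From mathcomp Require Import all_classical all_reals all_analysis.
Set Implicit Arguments.
Unset Strict Implicit.
Unset Printing Implicit Defensive.
Import Order.TTheory GRing.Theory Num.Theory.
Import numFieldNormedType.Exports.
Local Open Scope classical_set_scope.
Local Open Scope complex_scope.
Local Open Scope ring_scope.

(** Write [A^[d]] for [Aq d], and put [t = z - z0] and [Q_k = 1 - P_k].
    For [t != 0] each factor [P_k + t Q_k] has the inverse [P_k + t^-1 Q_k].
    Since the ranges of the projections increase, [P_k P_j = P_j] for [j <= k],
    and the product of these inverses telescopes:
      [(P_d + t^-1 Q_d) ... (P_1 + t^-1 Q_1) =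
         \sum_(j <= d) t^-j (P_(j+1) - P_j)],
    with [P_0 = 0] and [P_(d+1) = 1]. After multiplication by [t^d] this gives
    an identity valid at [z0] too (lemma [quotient_cofactor]),
      [t^d A^[d](z) = \sum_(j <= d) t^(d-j) (P_(j+1) - P_j) A(z)].

    The three claims are read off from it. Comparing the coefficients of
    [t^(d+k)] gives the formula for [G k]. Inverting it for [t != 0] gives
      [t^d A(z)^-1 = \sum_(j <= d) t^(d-j) A^[d](z)^-1 (P_(j+1) - P_j)],
    a power series whose constant term [H 0 (1 - P_d)] is nonzero because
    [H 0] is invertible and [P_d != 1]; so the pole has order exactly [d].
    Finally [A^[d](z) A^[d](z)^-1 = 1] turns, through the Cauchy product, into
    the recurrence for [H].

    Power series are moved around by convergence of partial sums as long as only
    shifts, sums and bounded linear maps are applied ([taylor_shift],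
    [taylor_sum], [taylor_map]). For products and for the uniqueness of
    coefficients they are first weakened to asymptotic expansions at [z0]
    ([taylor_expansion]), which suffice to determine the coefficients
    ([expansion_unique]) and multiply by an easy induction ([expansionM]). *)

(** * The algebra of bounded operators *)

Section OperatorAlgebra.
Variables (R : realType) (B : normedModType R[i]).
Local Notation L := (boundedop B).
Implicit Types (S T P : L) (c : R[i]).

Lemma boundedop_scalerAl c S T : c *: (S * T) = (c *: S) * T.
Proof. exact/boundedop_ext. Qed.

Lemma boundedop_scalerAr c S T : c *: (S * T) = S * (c *: T).
Proof. by apply/boundedop_ext => x; rewrite /= linearZ. Qed.

Lemma boundedop_normM S T : `|S * T| <= `|S| * `|T|.
Proof.
apply: opnorm_le => [|x]; first by rewrite mulr_ge0.
rewrite (le_trans (opnormP S _))// -mulrA ler_wpM2l ?opnorm_ge0//.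
exact: opnormP.
Qed.

Lemma lmul_bounded_linear S : (fun T => S * T) \in @bounded_linear R L.
Proof.
apply/asboolP; split=> [c T V|]; first by rewrite mulrDr boundedop_scalerAr.
by exists `|S| => T; exact: boundedop_normM.
Qed.

Lemma rmul_bounded_linear S : (fun T => T * S) \in @bounded_linear R L.
Proof.
apply/asboolP; split=> [c T V|]; first by rewrite mulrDl boundedop_scalerAl.
by exists `|S| => T; rewrite mulrC; exact: boundedop_normM.
Qed.

(** One-sided multiplications are themselves bounded operators on the space of
    operators, so facts about bounded operators cover both. *)
Definition lmul S : boundedop L := BoundedOp (lmul_bounded_linear S).
Definition rmul S : boundedop L := BoundedOp (rmul_bounded_linear S).

Lemma op_invP T : op_invertible T -> op_is_inverse T (op_inv T).
Proof. by move=> [S TS]; exact: (getPex (ex_intro _ S TS)). Qed.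

Lemma op_invertibleM T V :
  op_invertible T -> op_invertible V -> op_invertible (T * V).
Proof.
move=> [S [ST TS]] [W [WV VW]]; exists (W * S); split.
  by rewrite mulrA -(mulrA W) ST mulr1.
by rewrite mulrA -(mulrA T) VW mulr1.
Qed.

Lemma projection_mull P S :
  projection P -> range S `<=` range P -> P * S = S.
Proof.
move=> PP SP; apply/boundedop_ext => x /=.
have [y _ <-] : range P (S x) by apply: SP; exists x.
by rewrite -[in RHS]PP.
Qed.

(** [P] and [1 - P] are orthogonal idempotents, so their combinations multiply
    componentwise; this gives both the inverse of a factor [P + c (1 - P)] and
    the cofactor [c P + (1 - P)] that multiplies it to [c]. *)
Lemma projection_combM P (b b' c c' : R[i]) : projection P ->
  (b *: P + c *: (1 - P)) * (b' *: P + c' *: (1 - P)) =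
  (b * b') *: P + (c * c') *: (1 - P).
Proof.
move=> PP.
have PQ : P * (1 - P) = 0 by rewrite mulrBr mulr1 PP subrr.
have QP : (1 - P) * P = 0 by rewrite mulrBl mul1r PP subrr.
have QQ : (1 - P) * (1 - P) = 1 - P by rewrite mulrBl mul1r PQ subr0.
rewrite mulrDl !mulrDr -!boundedop_scalerAl -!boundedop_scalerAr.
by rewrite PP PQ QP QQ !scaler0 addr0 add0r !scalerA.
Qed.

Lemma factor_inverse c P : c != 0 -> projection P ->
  op_is_inverse (P + c *: (1 - P)) (P + c^-1 *: (1 - P)).
Proof.
move=> c0 PP; rewrite -[P in P + _]scale1r -[P in P + c^-1 *: _]scale1r.
split; rewrite projection_combM// !mul1r ?mulVf// ?mulfV//;
  by rewrite !scale1r addrC subrK.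
Qed.

Lemma cvg_boundedop (V : normedModType R[i]) (f : boundedop V)
    (u : nat -> V) l :
  u @ \oo --> l -> f \o u @ \oo --> f l.
Proof.
move=> /cvgrPdist_le ul; apply/cvgrPdist_le => e e0.
have M0 : 0 < opnorm f + 1 by rewrite ltr_wpDl ?opnorm_ge0.
have := ul (e / (opnorm f + 1)) (divr_gt0 e0 M0); apply: filterS => n un /=.
rewrite -linearB (le_trans (opnormP _ _))//.
rewrite (@le_trans _ _ ((opnorm f + 1) * `|l - u n|))//.
  by rewrite ler_wpM2r// lerDl.
by rewrite mulrC -ler_pdivlMr.
Qed.

End OperatorAlgebra.

(** * Operator-valued power series and asymptotic expansions *)

Section PowerSeries.
Variables (R : realType) (B : normedModType R[i]).
Local Notation L := (boundedop B).
Implicit Types (f g : R[i] -> L) (a b : nat -> L) (w : R[i]).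

(** The coefficients of [(z - w) ^+ m] times the series with coefficients [a]. *)
Definition shift_coef m a : nat -> L :=
  fun n => if (n < m)%N then 0 else a (n - m)%N.

Lemma near_eq_taylor f g w a :
  (\forall z \near w, f z = g z) -> taylor f w a -> taylor g w a.
Proof. by move=> fg; apply: filterS2 fg => z ->. Qed.

Lemma eq_cvgn (V : topologicalType) (u v : nat -> V) (l : V) :
  u =1 v -> u @ \oo --> l -> v @ \oo --> l.
Proof. by move=> /funext ->. Qed.

Lemma taylor_map (phi : boundedop L) f w a :
  taylor f w a -> taylor (fun z => phi (f z)) w (fun j => phi (a j)).
Proof.
apply: filterS => z /(cvg_boundedop (f := phi)); apply: eq_cvgn => n.
rewrite /series/= linear_sum.
by apply: eq_bigr => j _; rewrite linearZ.
Qed.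

Lemma taylorD f g w a b : taylor f w a -> taylor g w b ->
  taylor (f \+ g) w (a \+ b).
Proof.
apply: filterS2 => z fa gb; apply: eq_cvgn (cvgD fa gb) => n.
by rewrite fctE /series/= -big_split; apply: eq_bigr => j _; rewrite scalerDr.
Qed.

Lemma taylor0 w : taylor (fun=> 0 : L) w (fun=> 0).
Proof.
apply: filterE => z; apply: cvg_near_cst; near=> n.
by rewrite /series/= big1// => j _; rewrite scaler0.
Unshelve. all: by end_near. Qed.

Lemma taylor_sum (f : nat -> R[i] -> L) w (a : nat -> nat -> L) n :
  (forall i, taylor (f i) w (a i)) ->
  taylor (fun z => \sum_(0 <= i < n) f i z) w
         (fun j => \sum_(0 <= i < n) a i j).
Proof.
move=> fa; elim: n => [|n IH].
  rewrite (_ : (fun z => _) = fun=> 0); last first.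
    by apply/funext=> z; rewrite big_nil.
  rewrite (_ : (fun j => _) = fun=> 0); first exact: taylor0.
  by apply/funext=> z; rewrite big_nil.
rewrite (_ : (fun z => _) =
    (fun z => \sum_(0 <= i < n) f i z) \+ f n); last first.
  by apply/funext=> z; rewrite big_nat_recr.
rewrite (_ : (fun j => _) = (fun j => \sum_(0 <= i < n) a i j) \+ a n).
  exact: taylorD.
by apply/funext=> z; rewrite big_nat_recr.
Qed.

Lemma taylor_shift m f w a : taylor f w a ->
  taylor (fun z => (z - w) ^+ m *: f z) w (shift_coef m a).
Proof.
apply: filterS => z fa; rewrite -(cvg_shiftn m).
apply: eq_cvgn (cvgZl_tmp (k := (z - w) ^+ m) fa) => n.
rewrite /series/=.
rewrite addnC [RHS](big_cat_nat _ (n := m)) ?leq_addr//=.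
rewrite [X in _ = X + _]big_nat [X in _ = X + _]big1 ?add0r;
    last by move=> j /andP[_ jm]; rewrite /shift_coef jm scaler0.
rewrite -[X in _ = \sum_(X <= i < _) _]add0n big_addn addKn scaler_sumr.
apply: eq_bigr => j _.
by rewrite /shift_coef ltnNge leq_addl addnK scalerA exprD mulrC.
Qed.

(** The bounds concern the punctured neighbourhood only, so that an expansion
    may be divided by [z - w]. *)
Definition expansion f w a : Prop := forall n, exists2 C : R[i], 0 <= C &
  \forall z \near w^',
    `|f z - \sum_(0 <= j < n) (z - w) ^+ j *: a j| <= C * `|z - w| ^+ n.

Lemma sum_expr_le2 (q : R[i]) m : 0 <= q <= 2^-1 ->
  \sum_(0 <= i < m) q ^+ i <= 2.
Proof.
move=> /andP[q0 q1]; elim: m => [|m IH]; first by rewrite big_nil.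
rewrite big_nat_recl// expr0 (eq_bigr (fun i => q * q ^+ i)) => [|i _].
  rewrite -mulr_sumr (_ : 2 = 1 + 2^-1 * 2) ?lerD2l ?ler_pM ?sumr_ge0//.
    by move=> i _; rewrite exprn_ge0.
  by rewrite mulVf ?pnatr_eq0.
by rewrite exprS.
Qed.

(** Convergence at one point at distance [r] from [w] bounds the terms
    [a j * r ^+ j]; for [z] within [r / 2] the tail after [n] terms is then
    dominated by a geometric series of ratio at most 1/2, of size
    [O (`|z - w| ^+ n)]. *)
Lemma taylor_expansion f w a : taylor f w a -> expansion f w a.
Proof.
move=> fa n; have /nbhs_normP[e /= e0 Be] := fa.
pose r := e / 2; have r0 : 0 < r by rewrite divr_gt0.
have [C C0 aC] : exists2 C : R[i], 0 <= C & forall j, `|a j| * r ^+ j <= C.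
  have /Be cv : ball_ Num.norm w e (w + r).
    rewrite /ball_/= opprD addrA subrr add0r normrN gtr0_norm//.
    by rewrite /r ltr_pdivrMr// ltr_pMr// ltr1n.
  have /cvg_seq_bounded := cvgP _ cv.
  case/(ex_bound _ (PF := globally_properfilter (a := 0%N) I)) => M /= MP.
  have {}MP k : `|[series (w + r - w) ^+ j *: a j]_j k| <= M by apply: MP.
  exists (M + M) => [|j]; first by rewrite addr_ge0// (le_trans _ (MP 0%N)).
  have aE : r ^+ j *: a j = [series (w + r - w) ^+ j *: a j]_j j.+1 -
                            [series (w + r - w) ^+ j *: a j]_j j.
    by rewrite /series/= big_nat_recr//= addrAC subrr add0r [w + r]addrC addrK.
  rewrite mulrC -[r]gtr0_norm// -normrX -normrZ aE (le_trans (ler_normB _ _))//.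
  exact: lerD.
(* the tail is at most C q ^+ n (1 + q + ...) <= 2 C q ^+ n, q = `|z - w| / r *)
exists (C * 2 / r ^+ n).
  by rewrite !mulr_ge0// invr_ge0 exprn_ge0// ltW.
apply: nbhs_dnbhs; apply/nbhs_normP; exists (r / 2) => /=.
  by rewrite divr_gt0.
move=> z; rewrite /ball_/= => zr.
have q0 : 0 <= `|z - w| / r <= 2^-1.
  rewrite divr_ge0 ?(ltW r0)//= ler_pdivrMr// mulrC distrC ltW//.
set q := `|z - w| / r in q0.
have /Be/cvgrPdist_le cv : ball_ Num.norm w e z.
  rewrite /ball_/= (lt_trans zr)// /r ltr_pdivrMr// ltr_pdivrMr//.
  by rewrite -mulrA ltr_pMr// -natrM ltr1n.
(* compare f z with a partial sum that is eps-close to it *)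
apply/ler_addgt0Pl => eps eps0.
have [N _ NP] := cv eps eps0.
pose m := (n + N)%N.
have /NP /= : (N <= m)%N by rewrite leq_addl.
rewrite /series/= => fm.
rewrite -(subrKA (\sum_(0 <= j < m) (z - w) ^+ j *: a j)).
rewrite (le_trans (ler_normD _ _))// lerD//.
rewrite /m (big_cat_nat _ (n := n)) ?leq_addr//= addrAC subrr add0r.
rewrite -{1}[n]add0n big_addn addKn.
rewrite (le_trans (ler_norm_sum _ _ _))//.
rewrite (@le_trans _ _ (\sum_(0 <= i < N) C * q ^+ n * q ^+ i))//.
  apply: ler_sum => i _; rewrite normrZ normrX -mulrA -exprD addnC.
  rewrite (_ : `|z - w| = q * r); last by rewrite /q divfK ?gt_eqF.
  rewrite exprMn -mulrA [X in _ <= X]mulrC.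
  rewrite ler_wpM2l ?exprn_ge0//; first by case/andP: q0.
  by rewrite mulrC aC.
rewrite -mulr_sumr /q expr_div_n.
rewrite [X in X <= _](_ : _ =
    C / r ^+ n * `|z - w| ^+ n * \sum_(0 <= i < N) q ^+ i); last first.
  by rewrite /q; congr (_ * _); rewrite mulrA mulrAC.
rewrite [X in _ <= X](_ : _ = C / r ^+ n * `|z - w| ^+ n * 2); last first.
  by rewrite -!mulrA; congr (_ * _); rewrite mulrC -!mulrA.
rewrite ler_wpM2l ?sum_expr_le2// !mulr_ge0// ?exprn_ge0// invr_ge0.
by rewrite exprn_ge0// ltW.
Qed.

Lemma expansion1 w : expansion (fun=> 1) w (fun n => if n is 0 then 1 else 0).
Proof.
case=> [|n]; exists `|1 : L| => //; apply: filterE => z.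
  by rewrite big_nil subr0 expr0 mulr1.
rewrite big_nat_recl// expr0 scale1r big1 ?addr0 ?subrr ?normr0 ?mulr_ge0//.
by move=> j _; rewrite scaler0.
Qed.

Lemma expansion_divX f w a : expansion f w a ->
  expansion (fun z => (z - w)^-1 *: (f z - a 0%N)) w (a \o S).
Proof.
move=> fa n; have [C C0 fC] := fa n.+1; exists C => //.
have := @nbhs_dnbhs_neq R[i] w; apply: filterS2 fC => z fz zw.
have t0 : z - w != 0 by rewrite subr_eq0.
rewrite -(ler_pM2l (x := `|z - w|)) ?normr_gt0// mulrCA -exprS.
apply: le_trans fz; rewrite -normrZ scalerBr scalerA mulfV// scale1r.
rewrite big_nat_recl// expr0 scale1r opprD addrA scaler_sumr.
rewrite (eq_bigr (fun j => (z - w) ^+ j.+1 *: a j.+1))// => j _.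
by rewrite scalerA -exprS.
Qed.

(** The Cauchy product without rearranging a double series: writing
    [f = a 0 + (z - w) f1], the order-[n.+1] remainder of [f g] is [a 0] times
    that of [g] plus [z - w] times the order-[n] remainder of [f1 g]. *)
Lemma expansionM f g w a b : expansion f w a -> expansion g w b ->
  expansion (fun z => f z * g z) w
            (fun n => \sum_(0 <= k < n.+1) a k * b (n - k)%N).
Proof.
move=> fa gb n; elim: n f a fa => [|n IH] f a fa.
  have [[C C0 fC] [D D0 gD]] := (fa 0%N, gb 0%N).
  exists (C * D) => [|]; first exact: mulr_ge0.
  apply: filterS2 fC gD => z; rewrite !big_nil !subr0 expr0 !mulr1 => fC gD.
  by rewrite (le_trans (boundedop_normM _ _))// ler_pM.
have [[C C0 fC] [D D0 gD]] := (IH _ _ (expansion_divX fa), gb n.+1).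
exists (`|a 0%N| * D + C); first by rewrite addr_ge0// mulr_ge0.
have := @nbhs_dnbhs_neq R[i] w; apply: filterS3 fC gD => z fz gz zw.
have t0 : z - w != 0 by rewrite subr_eq0.
set f1 := _ *: _ in fz; set s1 := \sum_(_ <= _ < _) _ in fz.
set s := \sum_(_ <= _ < _) _ in gz.
have -> : f z = a 0%N + (z - w) *: f1.
  by rewrite /f1 scalerA mulfV// scale1r addrC subrK.
set c := \sum_(_ <= _ < _) _.
have -> : c = a 0%N * s + (z - w) *: s1.
  rewrite /c /s /s1 big_nat_recl// [in RHS]big_nat_recl// mulrDr -addrA.
  rewrite big_nat1 subn0 boundedop_scalerAr; congr (_ + _).
  rewrite scaler_sumr mulr_sumr -big_split; apply: eq_bigr => k _.
  rewrite big_nat_recl// scalerDr boundedop_scalerAr subn0 scalerA -exprS.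
  by [].
rewrite mulrDl -boundedop_scalerAl opprD addrACA -mulrBr -scalerBr.
rewrite (le_trans (ler_normD _ _))// mulrDl lerD//.
  by rewrite (le_trans (boundedop_normM _ _))// -mulrA ler_wpM2l.
by rewrite normrZ exprS mulrCA ler_wpM2l.
Qed.

(** If the coefficients agree below [n], comparing the two order-[n.+1]
    remainders and dividing by [`|z - w| ^+ n] gives
    [`|a n - b n| = O (`|z - w|)]. *)
Lemma expansion_unique f w a b : expansion f w a -> expansion f w b -> a =1 b.
Proof.
move=> fa fb n; elim/ltn_ind: n => n IH.
have [[C C0 fC] [D D0 fD]] := (fa n.+1, fb n.+1).
apply/eqP; rewrite -subr_eq0 -normr_le0; apply/ler_addgt0Pl => e e0.
have M0 : 0 < C + D + 1 by rewrite ltr_wpDl ?addr_ge0.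
have near_e : \forall z \near w^', `|z - w| <= e / (C + D + 1).
  apply: nbhs_dnbhs; apply/nbhs_normP; exists (e / (C + D + 1)) => /=.
    exact: divr_gt0.
  by move=> z; rewrite /ball_/= distrC => /ltW.
have [z [[fz gz] [ze zw]]] := filter_ex (filterI (filterI fC fD)
  (filterI near_e (@nbhs_dnbhs_neq R[i] w))).
have t0 : 0 < `|z - w| by rewrite normr_gt0 subr_eq0.
rewrite addr0 -(ler_pM2l (exprn_gt0 n t0)) -normrX -normrZ normrX.
have -> : (z - w) ^+ n *: (a n - b n) =
    (f z - \sum_(0 <= j < n.+1) (z - w) ^+ j *: b j) -
    (f z - \sum_(0 <= j < n.+1) (z - w) ^+ j *: a j).
  rewrite opprB [RHS]addrC addrA subrK !big_nat_recr//=.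
  rewrite [X in X + _ - _](eq_big_nat _ _ (F2 := fun j => (z - w) ^+ j *: b j)).
    by rewrite opprD addrACA subrr add0r scalerBr.
  by move=> j /andP[_ jn]; rewrite IH.
rewrite (le_trans (ler_normB _ _))// (le_trans (lerD gz fz))//.
rewrite -mulrDl exprSr mulrCA ler_wpM2l ?exprn_ge0//.
rewrite (@le_trans _ _ ((C + D + 1) * `|z - w|))//.
  by rewrite ler_wpM2r// addrC lerDl.
by rewrite mulrC -ler_pdivlMr.
Qed.

Lemma taylor_center f w a : taylor f w a -> f w = a 0%N.
Proof.
move=> /nbhs_singleton fa; apply: (cvg_unique _ fa).
  exact: norm_hausdorff.
apply: cvg_near_cst; exists 1%N => // -[//|n] _.
rewrite /series/= big_nat_recl// expr0 scale1r big1 ?addr0// => j _.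
by rewrite subrr expr0n scale0r.
Qed.

End PowerSeries.

(** * Fredholm quotients *)

Section FredholmQuotients.
Variables (R : realType) (B : normedModType R[i]).
Local Notation L := (boundedop B).
Variables (U : set R[i]) (z0 : R[i]) (A : R[i] -> L).
Variables (P : nat -> L) (Aq : nat -> R[i] -> L).
Hypothesis quotA : fredholm_quotients U z0 A P Aq.

(** Away from [z0] every factor [P k + (z - z0) (1 - P k)] is invertible. *)
Lemma invertible_quotient n z : U z -> z != z0 -> op_invertible (A z) ->
  op_invertible (Aq n z).
Proof.
case: quotA => q0 q Uz zz0 invA; elim: n => [|n IH]; first by rewrite q0.
have t0 : z - z0 != 0 by rewrite subr_eq0.
have [PP _ _ _ fac] := q n.
have [EF FE] := factor_inverse t0 PP.
rewrite -[Aq n.+1 z]mul1r -EF -mulrA -fac//.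
by apply: op_invertibleM => //; exists (P n.+1 + (z - z0) *: (1 - P n.+1)).
Qed.

Variable d : nat.
Hypothesis ranP : forall k, (0 < k < d)%N -> range (P k) `<=` range (P k.+1).
Hypothesis P0 : P 0%N = 0.

(** Only the products in this order are determined by the nesting of ranges;
    [P j * P k] depends on the kernels. *)
Lemma projection_chain j k : (j <= k)%N -> (0 < k <= d)%N -> P k * P j = P j.
Proof.
case: j => [|j] jk /andP[k0 kd]; first by rewrite P0 mulr0.
case: quotA => _ q.
apply: projection_mull; first by case: k k0 jk kd => // k _ _ _; case: (q k).
elim: k jk k0 kd => // k IH; rewrite leq_eqVlt => /orP[/eqP[->]|jk] _ kd.
  exact: subset_refl.
have k0 : (0 < k)%N by exact: leq_trans (ltn0Sn j) jk.
by apply: (subset_trans (IH jk k0 (ltnW kd))); apply: ranP; rewrite k0.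
Qed.

(** [t ^+ n] times the inverse of the product of the first [n] factors
    [P k + t (1 - P k)]. The nested ranges make this inverse collapse to the
    telescoping form below whatever the kernels of the projections are. *)
Definition cofactor_poly n (t : R[i]) : L :=
  \sum_(0 <= j < n) t ^+ (n - j) *: (P j.+1 - P j) + (1 - P n).

(** Multiplying on the left by the cofactor of the next factor: [P n.+1] fixes
    every [P j.+1 - P j] with [j < n] and [1 - P n.+1] kills it, so that only
    the last summand [1 - P n] splits. *)
Lemma cofactor_polyS n t : (n < d)%N ->
  (t *: P n.+1 + (1 - P n.+1)) * cofactor_poly n t = cofactor_poly n.+1 t.
Proof.
move=> nd; have chain j : (j <= n.+1)%N -> P n.+1 * P j = P j.
  by move=> jn; apply: projection_chain.
rewrite mulrDl -boundedop_scalerAl mulrBl mul1r.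
have -> : P n.+1 * cofactor_poly n t =
    \sum_(0 <= j < n) t ^+ (n - j) *: (P j.+1 - P j) + (P n.+1 - P n).
  rewrite mulrDr mulrBr mulr1 chain//; congr (_ + _).
  rewrite mulr_sumr; apply: eq_big_nat => j /andP[_ jn].
  by rewrite -boundedop_scalerAr mulrBr !chain// ltnW// ltnW.
set s := \sum_(0 <= j < n) _.
have -> : cofactor_poly n t - (s + (P n.+1 - P n)) = 1 - P n.+1.
  by rewrite /cofactor_poly -/s opprD addrACA subrr add0r opprB addrA subrK.
rewrite /s /cofactor_poly big_nat_recr//= subSn// subnn expr1 scalerDr.
congr (_ + _ + _); rewrite scaler_sumr; apply: eq_big_nat => j /andP[_ jn].
by rewrite scalerA -exprS subSn// ltnW.
Qed.

Lemma quotient_cofactor n z : U z -> (n <= d)%N ->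
  (z - z0) ^+ n *: Aq n z = cofactor_poly n (z - z0) * A z.
Proof.
case: quotA => q0 q Uz; set t := z - z0; elim: n => [|n IH] nd.
  by rewrite /cofactor_poly big_nil P0 subr0 add0r scale1r mul1r q0.
have [PP _ _ _ fac] := q n.
rewrite -cofactor_polyS// -mulrA -IH 1?ltnW// fac// -/t.
rewrite -boundedop_scalerAr mulrA -[X in (_ + X) * _]scale1r.
rewrite -[X in _ * (X + _)]scale1r projection_combM// mulr1 mul1r -scalerDr.
by rewrite addrC subrK -boundedop_scalerAl mul1r scalerA exprSr.
Qed.

Lemma cofactor_poly_last t : P d.+1 = 1 ->
  cofactor_poly d t = \sum_(0 <= j < d.+1) t ^+ (d - j) *: (P j.+1 - P j).
Proof. by move=> Pd1; rewrite big_nat_recr//= subnn scale1r Pd1. Qed.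

End FredholmQuotients.

(** * Pole order and coefficient formulas *)

Theorem proposition5 (R : realType) (B : completeNormedModType R[i])
    (sepB : separable B)
    (U : set R[i]) (openU : open U) (connU : connected U)
    (z0 : R[i]) (Uz0 : U z0)
    (A : R[i] -> boundedop B) (anA : analytic_on U A)
    (fredA : forall z, U z -> fredholm (A z))
    (invA : forall z, U z -> z != z0 -> op_invertible (A z))
    (ninvA : ~ op_invertible (A z0))
    (P : nat -> boundedop B) (Aq : nat -> R[i] -> boundedop B)
    (quotA : fredholm_quotients U z0 A P Aq)
    (d : nat) (d_gt0 : (0 < d)%N) (invAd : op_invertible (Aq d z0))
    (ranP : forall k, (0 < k < d)%N -> range (P k) `<=` range (P k.+1))
    (P0 : P 0%N = 0) (Pd : P d != 1)
    (Pdj : forall j, (0 < j)%N -> P (d + j)%N = 1)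
    (a G H : nat -> boundedop B)
    (taylorA : taylor A z0 a)
    (taylorG : taylor (Aq d) z0 G)
    (taylorH : taylor (fun z => op_inv (Aq d z)) z0 H) :
  [/\ pole_of_order (fun z => op_inv (A z)) z0 d,
      forall k, G k = \sum_(0 <= j < d.+1) (P j.+1 - P j) * a (k + j)%N,
      H 0%N = op_inv (G 0%N)
    & forall j, (0 < j)%N ->
        H j = - (op_inv (G 0%N) * \sum_(1 <= k < j.+1) G k * H (j - k)%N)].
Proof.
have nearU : \forall z \near z0, U z by apply: open_nbhs_nbhs.
have Pd1 : P d.+1 = 1 by rewrite -addn1 Pdj.
pose D j := P j.+1 - P j.
have quotE z : U z -> (z - z0) ^+ d *: Aq d z =
    \sum_(0 <= j < d.+1) (z - z0) ^+ (d - j) *: (D j * A z).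
  move=> Uz; rewrite (quotient_cofactor quotA ranP P0 Uz (leqnn d)).
  rewrite cofactor_poly_last// mulr_suml.
  by apply: eq_bigr => j _; rewrite boundedop_scalerAl.
have G0E := taylor_center taylorG.
have H0E := taylor_center taylorH.
have [invGG GinvG] : op_is_inverse (G 0%N) (op_inv (G 0%N)).
  by rewrite -G0E; apply: op_invP.
have invAq z : U z -> op_is_inverse (Aq d z) (op_inv (Aq d z)).
  move=> Uz; apply: op_invP; have [->//|zz0] := eqVneq z z0.
  by apply: (invertible_quotient quotA) => //; exact: invA.
have H0G : H 0%N = op_inv (G 0%N) by rewrite -H0E G0E.
split=> //.
- pose b j := \sum_(0 <= i < d.+1) shift_coef (d - i) (fun n => H n * D i) j.
  have tb : taylor (fun z => \sum_(0 <= i < d.+1)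
      (z - z0) ^+ (d - i) *: (op_inv (Aq d z) * D i)) z0 b.
    apply: taylor_sum => i; apply: taylor_shift.
    exact: (taylor_map (rmul (D i))).
  (* only the summand i = d, whose coefficients are not shifted, reaches b 0 *)
  have b0 : b 0%N = H 0%N * (1 - P d).
    rewrite /b big_nat_recr//= subnn /shift_coef ltnn subn0 /D Pd1.
    rewrite big_nat big1 ?add0r// => i /andP[_ id].
    by rewrite subn_gt0 id.
  exists b.
    apply/eqP => b00; move/negP: Pd; apply; rewrite eq_sym -subr_eq0; apply/eqP.
    have -> : 1 - P d = G 0%N * b 0%N by rewrite b0 mulrA H0G GinvG mul1r.
    by rewrite b00 mulr0.
  have := @nbhs_dnbhs_neq R[i] z0.
  apply: filterS2 (nbhs_dnbhs (filterI nearU tb)) => z [Uz sz] zz0.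
  have t0 : z - z0 != 0 by rewrite subr_eq0.
  have -> : op_inv (A z) = (z - z0) ^- d *:
      \sum_(0 <= i < d.+1) (z - z0) ^+ (d - i) *: (op_inv (Aq d z) * D i).
    have [_ AV] := op_invP (invA z Uz zz0).
    have [VAq _] := invAq z Uz.
    have := congr1 (fun T => op_inv (Aq d z) * T * op_inv (A z)) (quotE z Uz).
    rewrite -boundedop_scalerAr VAq -boundedop_scalerAl mul1r.
    move=> /(congr1 ( *:%R ((z - z0) ^- d))); rewrite scalerA mulVf ?expf_neq0//.
    rewrite scale1r => ->; congr (_ *: _).
    rewrite mulr_sumr mulr_suml; apply: eq_bigr => i _.
    by rewrite -boundedop_scalerAr -boundedop_scalerAl -!mulrA AV mulr1.
  apply: eq_cvgn (cvgZl_tmp (k := (z - z0) ^- d) sz) => n.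
  rewrite /series/= scaler_sumr; apply: eq_bigr => j _.
  by rewrite scalerA mulrC expfzDr// exprnN.
(* compare the coefficients of index d + k in quotE *)
- move=> k; have : shift_coef d G (d + k)%N =
      \sum_(0 <= j < d.+1) shift_coef (d - j) (fun n => D j * a n) (d + k)%N.
    pose f z := \sum_(0 <= j < d.+1) (z - z0) ^+ (d - j) *: (D j * A z).
    have tl : taylor f z0 (shift_coef d G).
      apply: near_eq_taylor (taylor_shift d taylorG).
      by apply: filterS nearU => z /quotE.
    have tr : taylor f z0 (fun n =>
        \sum_(0 <= j < d.+1) shift_coef (d - j) (fun n => D j * a n) n).
      apply: taylor_sum => j; apply: taylor_shift.
      exact: (taylor_map (lmul (D j))).
    exact: (expansion_unique (taylor_expansion tl) (taylor_expansion tr)).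
  rewrite /shift_coef ltnNge leq_addr/= addKn => ->.
  apply: eq_big_nat => j /andP[_ jd].
  rewrite ltnNge (leq_trans (leq_subr _ _) (leq_addr _ _))/= -addnBAC ?leq_subr//.
  by rewrite subKn// addnC.
- move=> j j0.
  have GH1 : expansion (fun=> 1) z0
      (fun n => \sum_(0 <= k < n.+1) G k * H (n - k)%N).
    have GH := expansionM (taylor_expansion taylorG) (taylor_expansion taylorH).
    move=> n; have [C C0 GHn] := GH n; exists C; first exact: C0.
    apply: filterS2 GHn (nbhs_dnbhs nearU) => z + Uz.
    by have [_ ->] := invAq z Uz.
  have := expansion_unique GH1 (@expansion1 _ _ z0) j.
  rewrite big_ltn// subn0; case: j j0 => // j _ /(canRL (addrK _)) GHj.
  by rewrite -[LHS]mul1r -invGG -mulrA GHj sub0r mulrN.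
Qed.
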